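(* Let $f:(0,\infty)\to\mathbb R$ be a decreasing convex function with $\lim_{x\to\infty}f(x)=0$, and let the networks in $\mathfrak N(x_0)$ be endowed with the systemic measure $\rho\big(\mathcal N(L_{\mathcal G})\big)=\sum_{i=2}^nf(\lambda_i(L_{\mathcal G}))$. Let $\mathcal N(L_{\mathcal G})\in\mathfrak N(x_0)$, let $k$ be a nonnegative integer, and let $\mathcal N(L_{\mathcal G}^{new})$ be any network obtained by adding at most $k$ new edges, with arbitrary positive weights, to the graph $\mathcal G$. Then $$\rho\big(\mathcal N(L_{\mathcal G}^{new})\big)\ \ge\ \sum_{i=k+2}^nf(\lambda_i),$$ where $0=\lambda_1\le\lambda_2\le\dots\le\lambda_n$ are the Laplacian eigenvalues of the original graph $\mathcal G$ (before adding new edges), and the sum is zero if $k+2>n$.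
   Context: Fix $n\ge 2$. All graphs are finite, simple, undirected, connected, on $n$ nodes, with positive edge weights: $\mathcal G=(V(\mathcal G),E(\mathcal G),w)$, $w:E(\mathcal G)\to(0,\infty)$. The Laplacian is $L_{\mathcal G}=\Delta-A$, where $A=[a_{ij}]$ has $a_{ij}=w(e)$ if $e=\{i,j\}\in E(\mathcal G)$ and $a_{ij}=0$ otherwise, and $\Delta=\mathrm{diag}(d_1,\dots,d_n)$ with $d_i=\sum_{e=\{i,j\}\in E(\mathcal G)}w(e)$. Its eigenvalues in ascending order are $\lambda_1(L_{\mathcal G})=0<\lambda_2(L_{\mathcal G})\le\dots\le\lambda_n(L_{\mathcal G})$. Let $M_n=I_n-\frac1n\mathbf 1_n\mathbf 1_n^T$. The linear consensus network $\mathcal N(L_{\mathcal G})$ is the system $\dot x=-L_{\mathcal G}x+\xi$, $y=M_nx$, with input $\xi$, output $y$ and fixed initial condition $x_0$; $\mathfrak N(x_0)$ is the set of all such networks. $L_{\mathcal G}^{new}$ denotes the Laplacian of the graph obtained from $\mathcal G$ after adding the new weighted edges. *)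

(* Defs.v *)
From HB Require Import structures.
From mathcomp Require Import all_boot all_order all_algebra.
From mathcomp Require Import polyrcf.
From mathcomp Require Import all_classical all_reals all_analysis.

Set Implicit Arguments.
Unset Strict Implicit.
Unset Printing Implicit Defensive.

Import Order.TTheory GRing.Theory Num.Theory.
Import numFieldNormedType.Exports.

Local Open Scope ring_scope.

(* Connected simple graphs on the node set 'I_n with positive edge weights.
   An edge is a two-element set of nodes; the values of [weight] outside
   [edges] are irrelevant. *)
Record wgraph (R : realType) (n : nat) := WGraph {
  edges : {set {set 'I_n}};
  weight : {set 'I_n} -> R;
  edges_card2 : forall e : {set 'I_n}, e \in edges -> #|e| = 2%N;
  weight_gt0 : forall e : {set 'I_n}, e \in edges -> 0 < weight e;
  wgraph_connected : forall i j : 'I_n,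
    connect [rel u v : 'I_n | [set u; v]%SET \in edges] i j }.

Section Laplacian.
Variables (R : realType) (n : nat) (G : wgraph R n).

Definition adjacency : 'M[R]_n :=
  \matrix_(i, j) if [set i; j]%SET \in edges G
                 then weight G [set i; j]%SET else 0.

Definition degree (i : 'I_n) : R := \sum_(e in edges G | i \in e) weight G e.

Definition laplacian : 'M[R]_n := diag_mx (\row_i degree i) - adjacency.

End Laplacian.

(* The real eigenvalues in ascending order, repeated according to their
   algebraic multiplicity ([rootsR] lists the distinct real roots in increasing
   order).  For a symmetric matrix there are no other eigenvalues, and the
   sequence has length n. *)
Definition eigenvalues (R : realType) (n : nat) (A : 'M[R]_n) : seq R :=
  flatten [seq nseq (mup x (char_poly A)) x | x <- rootsR (char_poly A)].

(* Indexed from 1: [lambda A 1] is the smallest eigenvalue. *)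
Definition lambda (R : realType) (n : nat) (A : 'M[R]_n) (i : nat) : R :=
  nth 0 (eigenvalues A) i.-1.

(* The system x' = A x + B xi, y = C x, x(0) = x0, given by (A, B, C, x0). *)
Record linear_network (R : realType) (n : nat) := LinearNetwork {
  state_mx : 'M[R]_n;
  input_mx : 'M[R]_n;
  output_mx : 'M[R]_n;
  initial_state : 'cV[R]_n }.

Definition centering_mx (R : realType) (n : nat) : 'M[R]_n :=
  1%:M - n%:R^-1 *: ((const_mx 1 : 'cV[R]_n) *m (const_mx 1 : 'cV[R]_n)^T).

Definition consensus_network (R : realType) (n : nat)
    (x0 : 'cV[R]_n) (L : 'M[R]_n) : linear_network R n :=
  LinearNetwork (- L) 1%:M (centering_mx R n) x0.

(* The Laplacian of a consensus network is the opposite of its state matrix. *)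
Definition systemic_measure (R : realType) (n : nat) (f : R -> R)
    (N : linear_network R n) : R :=
  \sum_(2 <= i < n.+1) f (lambda (- state_mx N) i).

Definition adds_at_most (R : realType) (n k : nat) (G Gnew : wgraph R n) : Prop :=
  exists F : {set {set 'I_n}},
    [/\ (#|F| <= k)%N,
        [disjoint F & edges G],
        edges Gnew = (edges G :|: F)%SET
      & {in edges G, weight Gnew =1 weight G}].

(* Main.v *)
(* Adding k edges perturbs the Laplacian by a sum of k matrices of rank one, so
   the new and old quadratic forms agree on a space of codimension at most k.
   Such a space, the span of the first j + k old eigenvectors and the span of the
   new eigenvectors of index at least j have a common nonzero vector, on which
   the quadratic forms give lambda_j(new) <= lambda_(j+k)(old).  As f is
   decreasing and, tending to 0, nonnegative, the terms with j + k <= n of the new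
   measure dominate the claimed bound, and the other ones are nonnegative. *)
Require Import Defs.
From HB Require Import structures.
From mathcomp Require Import all_boot all_order all_algebra.
From mathcomp Require Import fingroup perm spectral complex polyrcf zify.
From mathcomp Require Import all_classical all_reals all_analysis.
Import Order.TTheory GRing.Theory Num.Theory.
Import numFieldNormedType.Exports.
Local Open Scope classical_set_scope.
Local Open Scope ring_scope.
Local Open Scope sesquilinear_scope.

Section RealSymmetric.
Set Implicit Arguments.
Unset Strict Implicit.
Unset Printing Implicit Defensive.

Variable R : realType.
Local Notation C := R[i].
Local Notation toC := (real_complex R).

(** * Multiplicity and order in the sequence of eigenvalues *)

Lemma count_mem_eigenvalues (n : nat) (A : 'M[R]_n) (x : R) :
  count_mem x (eigenvalues A) = mup x (char_poly A).
Proof.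
have pA0 : char_poly A != 0 by rewrite monic_neq0 ?char_poly_monic.
rewrite count_flatten -map_comp sumnE big_map.
under eq_bigr => y _ do rewrite /= count_nseq /=.
have uniq_roots := sorted_uniq lt_trans ltxx (sorted_roots
  (- cauchy_bound (char_poly A)) (cauchy_bound (char_poly A)) (char_poly A)).
(* A root lies in exactly one constant block, as [rootsR] has no duplicates; a non-root lies in none
   and has multiplicity zero. *)
have [xr|/negPf xr] := boolP (x \in rootsR (char_poly A)).
  rewrite (bigD1_seq x) //= eqxx mul1n big1 ?addn0 // => y /negPf ->.
  by rewrite mul0n.
rewrite mupNroot; last first.
  by have /= := roots_on_rootsR pA0 x; rewrite xr => ->.
apply/big1_seq => y /=; case: eqP => [->|]; rewrite ?mul0n //.
by rewrite xr.
Qed.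

Lemma sorted_flatten_nseq (s : seq R) (m : R -> nat) :
  sorted <%R s -> sorted <=%R (flatten [seq nseq (m x) x | x <- s]).
Proof.
rewrite !sorted_pairwise; [|exact: le_trans|exact: lt_trans].
elim: s => //= x s IH /andP[xs ss]; rewrite pairwise_cat IH // andbT.
apply/andP; split.
  apply/allrelP => y z; rewrite mem_nseq => /andP[_ /eqP ->].
  move=> /flatten_mapP[t ts]; rewrite mem_nseq => /andP[_ /eqP ->].
  exact/ltW/(allP xs).
by elim: (m x) => //= k ->; rewrite andbT; apply/allP => y /nseqP[-> _].
Qed.

Lemma sorted_eigenvalues (n : nat) (A : 'M[R]_n) : sorted <=%R (eigenvalues A).
Proof. exact/sorted_flatten_nseq/sorted_roots. Qed.

Lemma perm_eigenvalues (n : nat) (A : 'M[R]_n) (d : seq R) :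
  char_poly A = \prod_(x <- d) ('X - x%:P) -> perm_eq (eigenvalues A) d.
Proof.
move=> dA; apply/allP => x _ /=.
by rewrite count_mem_eigenvalues dA mu_prod_XsubC.
Qed.

(** The size bound keeps [nth] away from its default 0, which could break monotonicity; index 0
    reads the same entry as index 1. *)
Lemma lambda_le (n : nat) (A : 'M[R]_n) (i j : nat) :
  (i <= j)%N -> (j.-1 < size (eigenvalues A))%N -> lambda A i <= lambda A j.
Proof.
move=> ij jA; apply: (sorted_leq_nth le_trans le_refl) => //.
- exact: sorted_eigenvalues.
- by rewrite inE (leq_ltn_trans _ jA) // -!subn1 leq_sub2r.
- by rewrite -!subn1 leq_sub2r.
Qed.

(** * Spectral decomposition of real symmetric matrices *)

Lemma char_poly_invmx (F : fieldType) (n : nat) (P A B : 'M[F]_n) :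
  P \in unitmx -> A = invmx P *m B *m P -> char_poly A = char_poly B.
Proof.
move=> Pu ->; rewrite /char_poly /char_poly_mx !map_mxM map_invmx.
set Q := map_mx _ P.
have Qu : Q \in unitmx by rewrite map_unitmx.
have -> : 'X%:M - invmx Q *m map_mx polyC B *m Q =
          invmx Q *m ('X%:M - map_mx polyC B) *m Q.
  by rewrite mulmxBr mulmxBl scalar_mxC mulmxKV.
by rewrite !det_mulmx mulrAC -det_mulmx mulVmx // det1 mul1r.
Qed.

(** Complex diagonalization gives a real diagonal in unknown order; permuting the rows of the
    unitary matrix sorts it. *)
Lemma symmetric_spectral (n : nat) (A : 'M[R]_n) : A^T = A ->
  size (eigenvalues A) = n /\
  exists2 P : 'M[C]_n, P \is unitarymx &
    map_mx toC A = P^t* *m diag_mx (\row_i toC (lambda A i.+1)) *m P.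
Proof.
move=> Asym; set B := map_mx toC A.
have Bherm : B \is hermsymmx.
  apply: realsym_hermsym.
    by apply/is_hermitianmxP; rewrite expr0 scale1r map_mx_id // /B map_trmx Asym.
  by apply/mxOverP => i j; rewrite mxE; apply/complex_realP; exists (A i j).
have /orthomx_spectralP BE := hermitian_normalmx Bherm.
have /mxOverP Dreal := hermitian_spectral_diag_real Bherm.
have Pun := spectral_unitarymx B.
move: BE Dreal Pun; set P := spectralmx B; set D := spectral_diag B.
move=> BE Dreal Pun.
pose d := [tuple complex.Re (D 0 i) | i < n].
have dA : perm_eq (eigenvalues A) d.
  (* The factorization is checked over [C], where [A] is diagonalized, and descends to [R] by
     injectivity of the embedding. *)
  apply: perm_eigenvalues; apply: (map_inj_poly (@complexI R) (rmorph0 _)).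
  rewrite map_char_poly (char_poly_invmx (unitarymx_unit Pun) BE).
  rewrite char_poly_trig ?diag_mx_is_trig // rmorph_prod /=.
  rewrite big_map big_enum /=; apply: eq_bigr => i _.
  by rewrite map_polyXsubC mxE eqxx mulr1n /= RRe_real.
have sA : size (eigenvalues A) = n by rewrite (perm_size dA) size_tuple.
split=> //.
have /tuple_permP[p pE] := dA.
exists (row_perm p P).
  rewrite row_permE mul_unitarymx //.
  apply/unitarymxP; rewrite tr_perm_mx map_perm_mx -perm_mxM mulgV perm_mx1 //.
have lE (i : 'I_n) : toC (lambda A i.+1) = D 0 (p i).
  rewrite /lambda pE /= (nth_map i) ?size_enum_ord // nth_ord_enum.
  by rewrite tnth_mktuple RRe_real.
rewrite BE (invmx_unitary Pun) {1}row_permE trmx_mul map_mxM -!mulmxA.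
congr (_ *m _); rewrite tr_perm_mx map_perm_mx -row_permE !mul_diag_mx.
by apply/matrixP => i j; rewrite !mxE lE permKV.
Qed.

(** * Quadratic forms on spans of eigenvectors *)

(* The spectral theorem of the library is complex, so real symmetric matrices act
   here on complex row vectors. *)
Definition qform (n : nat) (A : 'M[R]_n) (v : 'rV[C]_n) : C :=
  (v *m map_mx toC A *m v^t*) 0 0.

Definition sqnorm (n : nat) (v : 'rV[C]_n) : C := (v *m v^t*) 0 0.

Lemma sqnormE (n : nat) (v : 'rV[C]_n) : sqnorm v = \sum_i `|v 0 i| ^+ 2.
Proof. by rewrite /sqnorm mxE; apply: eq_bigr => i _; rewrite !mxE normCK. Qed.

Lemma sqnorm_gt0 (n : nat) (v : 'rV[C]_n) : v != 0 -> 0 < sqnorm v.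
Proof.
move=> v0; rewrite sqnormE lt0r sumr_ge0 ?andbT => [|i _]; last exact: exprn_ge0.
apply: contra v0 => /eqP /psumr_eq0P v0; apply/eqP/rowP => i; rewrite !mxE.
by apply/eqP; rewrite -normr_eq0 -sqrf_eq0 v0 // => j _; exact: exprn_ge0.
Qed.

Lemma sqnorm_unitary (n : nat) (P : 'M[C]_n) (v : 'rV[C]_n) :
  P \is unitarymx -> sqnorm (v *m P^t*) = sqnorm v.
Proof.
move=> Pun; rewrite /sqnorm trmx_mul map_mxM trmxCK mulmxA.
by rewrite mulmxKtV.
Qed.

Lemma qform_diag (n : nat) (A : 'M[R]_n) (P : 'M[C]_n) (d : 'rV[C]_n)
    (v : 'rV[C]_n) : map_mx toC A = P^t* *m diag_mx d *m P ->
  qform A v = \sum_i d 0 i * `|(v *m P^t*) 0 i| ^+ 2.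
Proof.
move=> AE; rewrite /qform AE.
have -> : v *m (P^t* *m diag_mx d *m P) *m v^t* =
          v *m P^t* *m diag_mx d *m (v *m P^t*)^t*.
  by rewrite trmx_mul map_mxM trmxCK !mulmxA.
rewrite mxE; apply: eq_bigr => i _.
by rewrite mul_mx_diag !mxE mulrAC normCK mulrC.
Qed.

(** [U] is the span of the rows of [P] indexed by [S]. These rows are orthonormal, so [v *m P^t*]
    lists the coordinates of [v] in them. *)
Lemma unitary_row_space (n : nat) (P : 'M[C]_n) (S : {set 'I_n}) :
  P \is unitarymx ->
  exists2 U : 'M[C]_n, \rank U = #|S| &
    forall v : 'rV_n, (v <= U)%MS ->
      forall i, i \notin S -> (v *m P^t*) 0 i = 0.
Proof.
move=> Pun; pose E : 'M[C]_(#|S|, n) := rowsub enum_val 1%:M.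
have Eun : E \is unitarymx.
  apply/unitarymxP/matrixP => a b; rewrite !mxE (bigD1 (enum_val b)) //=.
  rewrite !mxE eqxx conjC1 mulr1 (inj_eq enum_val_inj) big1 ?addr0 //.
  by move=> i /negPf ib; rewrite !mxE [enum_val b == _]eq_sym ib conjC0 mulr0.
(* The brackets give a square matrix with the row space of the rectangular [E *m P]. *)
exists <<E *m P>>%MS; first by rewrite genmxE mxrank_unitary ?mul_unitarymx.
move=> v; rewrite genmxE => /submxP[w ->] i iS.
rewrite mulmxA mulmxtVK // mxE big1 // => a _; rewrite !mxE.
case: eqP => [ai|]; last by rewrite mulr0.
by rewrite -ai enum_valP in iS.
Qed.

Lemma card_ord_lt (n j : nat) : (j <= n)%N -> #|[set i : 'I_n | (i < j)%N]%SET| = j.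
Proof.
move=> jn; have -> : [set i : 'I_n | (i < j)%N]%SET =
    [set widen_ord jn i | i in 'I_j]%SET.
  apply/setP => i; rewrite inE; apply/idP/imsetP => [ij|[a _ ->]] //=.
  by exists (Ordinal ij) => //; exact: val_inj.
rewrite card_imset ?card_ord // => a b ab; apply: val_inj.
by have := congr1 val ab.
Qed.

(** In an orthonormal eigenbasis the form is a sum of squared moduli weighted by eigenvalues; on the
    span of the first [j] eigenvectors no weight exceeds the [j]-th. *)
Lemma lambda_lower_space (n : nat) (A : 'M[R]_n) (j : nat) :
  A^T = A -> (j <= n)%N ->
  exists2 U : 'M[C]_n, \rank U = j &
    forall v : 'rV_n, (v <= U)%MS -> qform A v <= toC (lambda A j) * sqnorm v.
Proof.
move=> /symmetric_spectral[sA [P Pun AE]] jn.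
have [U Urank UP] := unitary_row_space [set i : 'I_n | (i < j)%N]%SET Pun.
exists U; first by rewrite Urank card_ord_lt.
move=> v /UP vU; rewrite -(sqnorm_unitary v Pun) sqnormE (qform_diag v AE).
rewrite mulr_sumr; apply: ler_sum => i _.
have [ij|ij] := ltnP i j; last by rewrite vU ?inE -?leqNgt // normr0 expr0n !mulr0.
rewrite mxE ler_wpM2r ?exprn_ge0 // lecR lambda_le // sA.
by move: jn ij; clear; lia.
Qed.

(** Dual bound, on the span of the eigenvectors left after the first [j]: the smallest weight there
    is number [j.+1]. *)
Lemma lambda_upper_space (n : nat) (A : 'M[R]_n) (j : nat) :
  A^T = A -> (j < n)%N ->
  exists2 U : 'M[C]_n, \rank U = (n - j)%N &
    forall v : 'rV_n, (v <= U)%MS -> toC (lambda A j.+1) * sqnorm v <= qform A v.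
Proof.
move=> /symmetric_spectral[sA [P Pun AE]] jn.
have [U Urank UP] := unitary_row_space (~: [set i : 'I_n | (i < j)%N])%SET Pun.
exists U; first by rewrite Urank cardsCs finset.setCK card_ord card_ord_lt // ltnW.
move=> v /UP vU; rewrite -(sqnorm_unitary v Pun) sqnormE (qform_diag v AE).
rewrite mulr_sumr; apply: ler_sum => i _.
have [ij|ij] := ltnP i j; first by rewrite vU ?inE ?negbK // normr0 expr0n !mulr0.
rewrite [X in _ <= X * _]mxE ler_wpM2r ?exprn_ge0 // lecR lambda_le // sA.
exact: ltn_ord.
Qed.

Lemma capmx_nonzero (F : fieldType) (n : nat) (U V : 'M[F]_n) :
  (n < \rank U + \rank V)%N ->
  exists v : 'rV_n, [/\ v != 0, (v <= U)%MS & (v <= V)%MS].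
Proof.
move=> UV; have /rowV0Pn[v] : (U :&: V)%MS != 0.
  rewrite -mxrank_eq0 -lt0n -(ltn_add2l (\rank (U + V)%MS)) addn0 mxrank_sum_cap.
  exact: leq_ltn_trans (rank_leq_col _) UV.
by rewrite sub_capmx => /andP[vU vV] v0; exists v.
Qed.

Lemma lambda_rank_perturbation (n : nat) (A B : 'M[R]_n) (j k : nat) :
  A^T = A -> B^T = B -> (\rank (B - A)%R <= k)%N -> (j.+1 + k <= n)%N ->
  lambda B j.+1 <= lambda A (j.+1 + k).
Proof.
move=> Asym Bsym BAk jkn.
have [U rU UA] := lambda_lower_space Asym jkn.
have jn : (j < n)%N by rewrite (leq_trans _ jkn) // leq_addr.
have [W rW WB] := lambda_upper_space Bsym jn.
(* On [K] the two forms coincide; extending scalars to [C] preserves the rank of [B - A]. *)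
set K := kermx (map_mx toC (B - A)).
have rK : (n - k <= \rank K)%N by rewrite mxrank_ker mxrank_map leq_sub2l.
have [v [v0 vUW vK]] : exists v : 'rV_n,
    [/\ v != 0, (v <= U :&: W)%MS & (v <= K)%MS].
  (* The ranks [j.+1 + k] and [n - j] force [U] and [W] to meet in dimension at least [k.+1], more
     than the codimension of [K]. *)
  apply: capmx_nonzero.
  have := mxrank_sum_cap U W; have := rank_leq_col (U + W)%MS.
  rewrite rU rW; move: jkn rK; lia.
move: vUW; rewrite sub_capmx => /andP[/UA vA /WB vB].
have qAB : qform A v = qform B v.
  move: vK => /sub_kermxP; rewrite map_mxB mulmxBr => /subr0_eq.
  by rewrite /qform => ->.
move: (sqnorm_gt0 v0) => v_gt0.
by rewrite -lecR -(ler_pM2r v_gt0) (le_trans vB) // -qAB.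
Qed.

End RealSymmetric.

(** * Graph Laplacians as weighted sums over edges *)

Section WeightedGraph.
Set Implicit Arguments.
Unset Strict Implicit.
Unset Printing Implicit Defensive.

Variable R : realType.
Local Notation C := R[i].
Local Notation toC := (real_complex R).

(** For a two-element [e], the Laplacian of the single edge [e] with unit weight. The entrywise form
    avoids ordering its endpoints. *)
Definition edge_laplacian (n : nat) (e : {set 'I_n}) : 'M[R]_n :=
  \matrix_(i, j) if (i \in e) && (j \in e) then (if i == j then 1 else -1) else 0.

(** Factoring through the signed incidence vector of the edge yields both rank at most one and a
    form that is a squared difference. *)
Lemma edge_laplacian_pair (n : nat) (a b : 'I_n) : a != b ->
  edge_laplacian [set a; b]%SET =
  (delta_mx 0 a - delta_mx 0 b)^T *m (delta_mx 0 a - delta_mx 0 b : 'rV_n).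
Proof.
move=> /negPf ab; apply/matrixP => i j; rewrite !mxE big_ord1 !mxE !inE !eqxx /=.
case: (eqVneq i a) => [->|/negPf ia]; case: (eqVneq j a) => [->|/negPf ja].
- by rewrite ab /= subr0 mulr1.
- rewrite ab /=.
  by case: (j == b); rewrite /= ?subr0 ?sub0r ?mul1r.
- rewrite ab ia /=.
  by case: (i == b); rewrite /= ?subr0 ?sub0r ?mulr1.
- case: (eqVneq i b) => [->|_] /=; last by rewrite subr0 mul0r.
  by rewrite eq_sym; case: (eqVneq b j) => _; rewrite ?subr0 ?mulr0 // sub0r mulrNN mulr1.
Qed.

Lemma mxrank_edge_laplacian (n : nat) (e : {set 'I_n}) :
  #|e| = 2%N -> (\rank (edge_laplacian e) <= 1)%N.
Proof.
move=> /eqP/cards2P[a [b [ab ->]]]; rewrite edge_laplacian_pair //.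
exact: leq_trans (mulmx_max_rank _ _) _.
Qed.

Lemma qform_edge_laplacian (n : nat) (a b : 'I_n) (v : 'rV[C]_n) : a != b ->
  qform (edge_laplacian [set a; b]%SET) v = `|v 0 a - v 0 b| ^+ 2.
Proof.
move=> ab; rewrite /qform edge_laplacian_pair //; set u := _ - _.
have vu : v *m map_mx toC u^T = (v 0 a - v 0 b)%:M.
  rewrite /u linearB /= !trmx_delta map_mxB !map_delta_mx mulmxBr -!colE.
  by apply/matrixP => i j; rewrite !ord1 !mxE eqxx mulr1n.
have uv : map_mx toC u *m v^t* = ((v 0 a - v 0 b)^*)%:M.
  rewrite /u map_mxB !map_delta_mx mulmxBl -!rowE.
  by apply/matrixP => i j; rewrite !ord1 !mxE eqxx mulr1n rmorphB.
by rewrite map_mxM mulmxA vu -mulmxA uv normCK -scalar_mxM mxE eqxx mulr1n.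
Qed.

Lemma qform_sum (n : nat) (T : finType) (S : {set T}) (w : T -> R)
    (A : T -> 'M[R]_n) (v : 'rV[C]_n) :
  qform (\sum_(e in S) w e *: A e) v = \sum_(e in S) toC (w e) * qform (A e) v.
Proof.
rewrite /qform raddf_sum mulmx_sumr mulmx_suml summxE; apply: eq_bigr => e _.
by rewrite /= map_mxZ -scalemxAr -scalemxAl mxE.
Qed.

Lemma laplacianE (n : nat) (G : wgraph R n) :
  laplacian G = \sum_(e in edges G) weight G e *: edge_laplacian e.
Proof.
apply/matrixP => i j; rewrite summxE !mxE.
have [<-{j}|ij] := eqVneq i j.
  (* On the diagonal the adjacency entry vanishes, since a singleton is not an edge. *)
  rewrite mulr1n finset.setUid; case: ifP => [/edges_card2|_].
    by rewrite cards1.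
  rewrite subr0 /degree big_mkcondr /=; apply: eq_bigr => e _.
  by rewrite !mxE eqxx andbb; case: ifP; rewrite ?mulr1 ?mulr0.
rewrite mulr0n sub0r.
(* Off the diagonal only the edge joining [i] and [j] contributes: a two-element set containing both
   is that edge. *)
have offE e : e \in edges G -> e != [set i; j]%SET ->
    (weight G e *: edge_laplacian e) i j = 0.
  move=> eG; rewrite !mxE; case: ifP => [/andP[ie je]|]; rewrite ?mulr0 //.
  rewrite eq_sym eqEcard cards2 ij (edges_card2 eG) andbT.
  by rewrite finset.subUset !finset.sub1set ie je.
case: ifP => [ijG|ijG]; last first.
  rewrite oppr0 big1 // => e eG; apply: offE => //.
  by apply: contraTneq eG => ->; rewrite ijG.
rewrite (bigD1 [set i; j]%SET) //= [X in _ + X]big1 ?addr0; last first.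
  by move=> e /andP[]; exact: offE.
by rewrite !mxE !inE !eqxx orbT (negPf ij) mulrN1.
Qed.

Lemma laplacian_sym (n : nat) (G : wgraph R n) : (laplacian G)^T = laplacian G.
Proof.
rewrite laplacianE raddf_sum; apply: eq_bigr => e _; rewrite /= linearZ /=.
by congr (_ *: _); apply/matrixP => i j; rewrite !mxE andbC eq_sym.
Qed.

(** Old edges keep their weights and cancel; each edge of [F] leaves a term of rank at most one. *)
Lemma mxrank_laplacianB (n k : nat) (G Gnew : wgraph R n) :
  adds_at_most k G Gnew -> (\rank (laplacian Gnew - laplacian G)%R <= k)%N.
Proof.
move=> [F [Fk FG GnewE wE]]; apply: leq_trans Fk.
have -> : laplacian Gnew - laplacian G =
    \sum_(e in F) weight Gnew e *: edge_laplacian e.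
  rewrite !laplacianE GnewE.
  rewrite (eq_bigl (mem [predU edges G & F])) => [|e]; last by rewrite !inE.
  rewrite bigU /=; last by rewrite disjoint_sym.
  rewrite (eq_bigr (fun e => weight G e *: edge_laplacian e)) => [|e /wE -> //].
  by rewrite addrAC subrr add0r.
rewrite -sum1_card; apply: (big_ind2 (fun (M : 'M[R]_n) m => \rank M <= m)%N).
- by rewrite mxrank0.
- by move=> M m N p Mm Np; exact: leq_trans (mxrank_add _ _) (leq_add Mm Np).
- move=> e eF; apply: leq_trans (mxrank_scale _ _) _.
  by apply/mxrank_edge_laplacian/(@edges_card2 _ _ Gnew); rewrite GnewE inE eF orbT.
Qed.

(** * Positivity of the Laplacian form and of the second eigenvalue *)

Lemma qform_laplacian_ge0 (n : nat) (G : wgraph R n) (v : 'rV[C]_n) :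
  0 <= qform (laplacian G) v.
Proof.
rewrite laplacianE qform_sum sumr_ge0 // => e eG.
have /eqP/cards2P[a [b [ab eE]]] := edges_card2 eG.
by rewrite {2}eE qform_edge_laplacian // mulr_ge0 ?exprn_ge0 // ler0c ltW // weight_gt0.
Qed.

(** A vanishing sum of nonnegative edge terms makes [v] agree across every edge, and connecting
    paths propagate this. *)
Lemma qform_laplacian_eq0 (n : nat) (G : wgraph R n) (v : 'rV[C]_n) :
  qform (laplacian G) v = 0 -> forall i j, v 0 i = v 0 j.
Proof.
move=> q0 i j; have := wgraph_connected G i j.
case/connectP => p; elim: p i => [|k p IH] i /= => [_ -> //|].
move=> /andP[ikG kp] /(IH _ kp) <-; have [->//|ik] := eqVneq i k.
suff : qform (edge_laplacian [set i; k]%SET) v = 0.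
  rewrite qform_edge_laplacian // => /eqP.
  by rewrite expf_eq0 normr_eq0 subr_eq0 => /eqP.
have w0 := weight_gt0 ikG; apply: (mulfI (x := toC (weight G [set i; k]%SET))).
  by rewrite fmorph_eq0 gt_eqF.
rewrite mulr0; move: q0; rewrite laplacianE qform_sum => /psumr_eq0P; apply=> //.
move=> e eG; have /eqP/cards2P[a [b [ab eE]]] := edges_card2 eG.
by rewrite {2}eE qform_edge_laplacian // mulr_ge0 ?exprn_ge0 // ler0c ltW // weight_gt0.
Qed.

(** Otherwise the form is at most 0 on a plane, which meets the hyperplane of vectors with zero sum.
    A nonzero common vector would be constant with zero sum. *)
Lemma lambda2_laplacian_gt0 (n : nat) (G : wgraph R n) :
  (2 <= n)%N -> 0 < lambda (laplacian G) 2.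
Proof.
move=> n2; rewrite ltNge; apply/negP => l2.
have [U rU UG] := lambda_lower_space (laplacian_sym G) n2.
have [v [v0 /UG vU]] : exists v : 'rV[C]_n,
    [/\ v != 0, (v <= U)%MS & (v <= kermx (const_mx 1 : 'cV_n))%MS].
  apply: capmx_nonzero; rewrite rU mxrank_ker.
  apply: (@leq_trans (2 + (n - 1))); first by lia.
  by rewrite leq_add2l leq_sub2l // rank_leq_col.
move=> /sub_kermxP/matrixP/(_ 0 0); rewrite !mxE => v_sum.
have q0 : qform (laplacian G) v = 0.
  apply/le_anti; rewrite qform_laplacian_ge0 andbT (le_trans vU) //.
  by rewrite mulr_le0_ge0 ?lecR // ltW // sqnorm_gt0.
have vE := qform_laplacian_eq0 q0.
case/eqP: v0; apply/rowP => i; rewrite mxE.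
move: v_sum; under eq_bigr => j _ do rewrite mxE mulr1 (vE j i).
rewrite sumr_const card_ord => /eqP; rewrite mulrn_eq0 => /orP[|/eqP //].
by rewrite eqn0Ngt (ltnW n2).
Qed.

(** A negative value [f x] would bound [f] from above beyond [x], contradicting the limit 0. *)
Lemma decreasing_cvg0_ge0 (f : R -> R) :
  (forall x y : R, 0 < x -> x <= y -> f y <= f x) ->
  f x @[x --> +oo] --> (0 : R) -> forall x, 0 < x -> 0 <= f x.
Proof.
move=> f_dec f_lim x x0; rewrite leNgt; apply/negP => fx0.
have [y [xy]] := filter_ex (filterI (nbhs_pinfty_ge (num_real x))
  (cvgr_gt _ f_lim _ fx0)).
by rewrite /= ltNge f_dec.
Qed.

End WeightedGraph.

Theorem theorem5 (R : realType) (n : nat) (n_ge2 : (2 <= n)%N)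
    (f : R -> R)
    (f_decreasing : forall x y : R, 0 < x -> x <= y -> f y <= f x)
    (f_convex : convex_function (`]0, +oo[ : set R) f)
    (f_lim : f x @[x --> +oo] --> (0 : R))
    (x0 : 'cV[R]_n) (G : wgraph R n) (k : nat) (Gnew : wgraph R n)
    (Gnew_G : adds_at_most k G Gnew) :
  systemic_measure f (consensus_network x0 (laplacian Gnew))
    >= \sum_(k.+2 <= i < n.+1) f (lambda (laplacian G) i).
Proof.
rewrite /systemic_measure /= opprK.
have Gnew_sym := laplacian_sym Gnew.
have [size_new _] := symmetric_spectral Gnew_sym.
have lnew_gt0 i : (2 <= i <= n)%N -> 0 < lambda (laplacian Gnew) i.
  move=> /andP[i2 i_n]; apply: lt_le_trans (lambda2_laplacian_gt0 Gnew n_ge2) _.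
  by rewrite lambda_le // size_new; lia.
have f_ge0 i : (2 <= i <= n)%N -> 0 <= f (lambda (laplacian Gnew) i).
  by move=> /lnew_gt0; exact: decreasing_cvg0_ge0.
(* If [k.+2] exceeds [n], the claimed bound is an empty sum. *)
have [nk|kn] := leqP n.+1 k.+2.
  by rewrite big_geq // big_nat sumr_ge0.
have -> : k.+2 = (2 + k)%N by [].
(* Shifting the old indices by [k] lets both sums start at 2; the new one is cut where the shifted
   one ends, leaving a nonnegative tail. *)
rewrite [leLHS]big_addn [leRHS](@big_cat_nat _ _ _ (n.+1 - k)) /=; [|lia..].
rewrite ler_wpDr //.
  by rewrite big_nat sumr_ge0 // => i ?; apply: f_ge0; lia.
(* Writing the index as a successor matches the perturbation bound; the case 0 lies outside the
   range. *)
rewrite !big_nat; apply: ler_sum => -[//|i] i_bounds; apply: f_decreasing.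
  by apply: lnew_gt0; lia.
apply: lambda_rank_perturbation; [exact: laplacian_sym|by []| |lia].
exact: mxrank_laplacianB.
Qed.
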